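(* Let $n \ge 1$ be an integer and let $r_n = \sqrt[4n]{2^{2n-1}|B_{2n}|}$, where $B_{2n}$ is the $2n$-th Bernoulli number. Then $$\binom{2n}{n} = \frac{\pi^{2n} r_n^{4n}}{(n!)^2\,\zeta(2n)}, \qquad \zeta(2n) = \frac{\pi^{2n} r_n^{4n}}{(n!)^2\binom{2n}{n}}.$$
   Context: $\zeta$ is the Riemann zeta function. Bernoulli numbers are in the standard convention $\frac{t}{e^t-1} = \sum_{k\ge 0} B_k \frac{t^k}{k!}$ (so $B_2 = 1/6$). *)

(* Defs.v *)
From Stdlib Require Import Reals Lra Lia Arith.
From Coquelicot Require Import Coquelicot.
Open Scope R_scope.

(** [B] is the sequence of Bernoulli numbers: [t / (exp t - 1)] is the sum of
    [B k * t ^ k / k!] for [t] near [0].  The point [t = 0] is excluded because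
    the left-hand side is there only a removable singularity.  Existence and
    uniqueness of [B] are [bernoulli_exists] and [bernoulli_unique] below. *)
Definition is_bernoulli (B : nat -> R) : Prop :=
  exists rho : R, 0 < rho /\
    forall t : R, 0 < Rabs t < rho ->
      is_series (fun k : nat => B k * t ^ k / INR (fact k)) (t / (exp t - 1)).

(** The Riemann zeta function on the real half-line [s > 1], where the
    Dirichlet series converges; [k] is shifted so that the sum starts at
    [1 / 1 ^ s].  The value is meaningless for [s <= 1]. *)
Definition zeta (s : R) : R := Series (fun k : nat => / Rpower (INR (S k)) s).

(** The nonnegative [m]-th root of [x >= 0], for [m >= 1].  The case [x = 0] is
    separate because [Rpower 0 y = 1]. *)
Definition nth_root (m : nat) (x : R) : R :=
  if Rlt_dec 0 x then Rpower x (/ INR m) else 0.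

Definition bernoulli_root (B : nat -> R) (n : nat) : R :=
  nth_root (4 * n) (2 ^ (2 * n - 1) * Rabs (B (2 * n)%nat)).

Lemma nth_root_pow (m : nat) (x : R) :
  (1 <= m)%nat -> 0 <= x -> 0 <= nth_root m x /\ nth_root m x ^ m = x.
Proof.
intros Hm Hx. unfold nth_root. destruct (Rlt_dec 0 x) as [H|H].
- split; [apply Rlt_le, exp_pos|].
  rewrite <- Rpower_pow by apply exp_pos.
  rewrite Rpower_mult, Rinv_l by (apply not_0_INR; lia).
  now apply Rpower_1.
- split; [lra|]. rewrite pow_i by lia. lra.
Qed.

Lemma is_bernoulli_pseries (B : nat -> R) (t l : R) :
  is_series (fun k : nat => B k * t ^ k / INR (fact k)) l <->
  is_pseries (fun k : nat => B k / INR (fact k)) t l.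
Proof.
unfold is_pseries.
split; apply is_series_ext; intros k; change (pow_n t k) with (t ^ k);
  unfold scal; simpl; unfold mult; simpl; unfold Rdiv; ring.
Qed.

Lemma exp_sub_1_neq_0 (t : R) : t <> 0 -> exp t - 1 <> 0.
Proof.
intros Ht H. apply Ht, exp_inv. rewrite exp_0. lra.
Qed.

(** Coefficients of the power series inverse of [(exp t - 1) / t]. *)
Fixpoint inv_table (n : nat) : nat -> R :=
  match n with
  | O => fun _ => 1
  | S m => fun k => if (k <=? m)%nat then inv_table m k
      else - sum_f_R0 (fun j => inv_table m j * / INR (fact (S (S m - j)))) m
  end.

Definition inv_coef (n : nat) : R := inv_table n n.

Lemma inv_table_coef (n k : nat) : (k <= n)%nat -> inv_table n k = inv_coef k.
Proof.
induction n as [|n IH]; intros H.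
- now replace k with 0%nat by lia.
- destruct (Nat.eq_dec k (S n)) as [->|Hk]; [reflexivity|].
  simpl. replace (k <=? n)%nat with true by (symmetry; apply Nat.leb_le; lia).
  apply IH; lia.
Qed.

Lemma inv_coef_S (n : nat) :
  inv_coef (S n) =
  - sum_f_R0 (fun j => inv_coef j * / INR (fact (S (S n - j)))) n.
Proof.
change (inv_coef (S n)) with (if (S n <=? n)%nat then inv_table n (S n)
  else - sum_f_R0 (fun j => inv_table n j * / INR (fact (S (S n - j)))) n).
replace (S n <=? n)%nat with false by (symmetry; apply Nat.leb_gt; lia).
f_equal. apply sum_eq. intros j Hj. now rewrite inv_table_coef.
Qed.

Lemma PS_mult_inv_coef (n : nat) :
  PS_mult inv_coef (fun k => / INR (fact (S k))) n =
  match n with O => 1 | S _ => 0 end.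
Proof.
unfold PS_mult. destruct n as [|n].
- unfold inv_coef; simpl; lra.
- rewrite tech5, inv_coef_S, Nat.sub_diag. simpl (fact 1). simpl (INR 1). lra.
Qed.

Lemma sum_inv_fact_le (n : nat) :
  sum_f_R0 (fun i => / INR (fact (S (S i)))) n <= 1 - / INR (fact (S (S n))).
Proof.
induction n as [|n IH]; [simpl; lra|].
rewrite tech5.
assert (H : / INR (fact (S (S (S n)))) <= / INR (fact (S (S n))) / 2).
{ rewrite (fact_simpl (S (S n))), mult_INR, Rinv_mult.
  assert (Hp := Rinv_0_lt_compat _ (INR_fact_lt_0 (S (S n)))).
  assert (H2 : / INR (S (S (S n))) <= / 2).
  { apply Rinv_le_contravar; [lra|]. rewrite !S_INR.
    assert (Hn := pos_INR n). lra. }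
  nra. }
lra.
Qed.

Lemma inv_coef_bound (n : nat) : Rabs (inv_coef n) <= 1.
Proof.
induction n as [n IH] using lt_wf_ind. destruct n as [|n].
- unfold inv_coef; simpl. rewrite Rabs_R1. lra.
- rewrite inv_coef_S, Rabs_Ropp.
  eapply Rle_trans; [apply Rsum_abs|].
  apply Rle_trans with (sum_f_R0 (fun i => / INR (fact (S (S i)))) n).
  + rewrite <- (sum_f_R0_skip (fun i => / INR (fact (S (S i))))).
    apply sum_Rle. intros j Hj.
    assert (Hp := Rinv_0_lt_compat _ (INR_fact_lt_0 (S (S n - j)))).
    rewrite Rabs_mult, (Rabs_pos_eq (/ _)) by lra.
    replace (S (S (n - j))) with (S (S n - j)) by lia.
    assert (Hb := IH j ltac:(lia)). nra.
  + assert (H := sum_inv_fact_le n).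
    assert (Hp := Rinv_0_lt_compat _ (INR_fact_lt_0 (S (S n)))). lra.
Qed.

Lemma CV_radius_ge_1 (a : nat -> R) :
  (forall n, Rabs (a n) <= 1) -> Rbar_le 1 (CV_radius a).
Proof.
intros H. apply CV_radius_bounded. exists 1. intros n.
rewrite pow1, Rmult_1_r. apply H.
Qed.

Lemma bernoulli_exists : exists B : nat -> R, is_bernoulli B.
Proof.
exists (fun k => inv_coef k * INR (fact k)), 1. split; [lra|].
intros t [Ht0 Ht1]. apply is_bernoulli_pseries.
assert (Hn : t <> 0) by (intros ->; rewrite Rabs_R0 in Ht0; lra).
apply is_pseries_ext with inv_coef.
{ intros n. change (inv_coef n = inv_coef n * INR (fact n) / INR (fact n)).
  field. apply INR_fact_neq_0. }
set (g := fun k => / INR (fact (S k))).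
assert (Hg : forall n, Rabs (g n) <= 1).
{ intros n. unfold g.
  rewrite Rabs_pos_eq by apply Rlt_le, Rinv_0_lt_compat, INR_fact_lt_0.
  rewrite <- Rinv_1. apply Rinv_le_contravar; [lra|].
  apply (le_INR 1), lt_O_fact. }
assert (Ca : Rbar_lt (Rabs t) (CV_radius inv_coef)).
{ eapply Rbar_lt_le_trans; [|apply CV_radius_ge_1, inv_coef_bound]. exact Ht1. }
assert (Cg : Rbar_lt (Rabs t) (CV_radius g)).
{ eapply Rbar_lt_le_trans; [|apply CV_radius_ge_1, Hg]. exact Ht1. }
assert (Sa := PSeries_correct _ _ (CV_radius_inside _ _ Ca)).
assert (Sg : is_pseries g t ((exp t - 1) / t)).
{ assert (H := is_pseries_decr_1 _ t (/ t) _ (Rinv_l t Hn) (is_exp_Reals t)).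
  unfold scal, plus, opp in H; simpl in H; unfold mult in H; simpl in H.
  rewrite Rinv_1 in H.
  replace ((exp t - 1) / t) with (/ t * (exp t + - (1))) by (field; exact Hn).
  exact H. }
assert (M := is_pseries_mult _ _ _ _ _ Sa Sg Ca Cg).
assert (M1 : PSeries (PS_mult inv_coef g) t = 1).
{ rewrite PSeries_decr_1 by (eexists; exact M).
  replace (PS_mult inv_coef g 0) with 1 by (symmetry; exact (PS_mult_inv_coef 0)).
  rewrite (PSeries_ext _ (fun _ => 0))
    by (intros n; apply (PS_mult_inv_coef (S n))).
  rewrite PSeries_const_0. ring. }
rewrite (is_pseries_unique _ _ _ M) in M1.
replace (t / (exp t - 1)) with (PSeries inv_coef t); [exact Sa|].
assert (He := exp_sub_1_neq_0 t Hn).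
transitivity (PSeries inv_coef t * ((exp t - 1) / t) * (t / (exp t - 1))).
- field. split; assumption.
- rewrite M1. ring.
Qed.

Lemma pseries_CV_radius_pos (a : nat -> R) (t l : R) :
  0 < t -> is_pseries a t l -> Rbar_lt 0 (CV_radius a).
Proof.
intros Ht H. apply Rbar_not_le_lt. intros Hc.
apply (CV_disk_outside a t).
- eapply Rbar_le_lt_trans; [exact Hc|]. simpl. rewrite Rabs_pos_eq; lra.
- apply (ex_series_lim_0 (fun n => a n * t ^ n)). exists l.
  apply (is_series_ext (fun k => scal (pow_n t k) (a k))); [|exact H].
  intros k. change (pow_n t k) with (t ^ k). unfold scal; simpl; unfold mult; simpl. ring.
Qed.

Lemma bernoulli_unique (B B' : nat -> R) :
  is_bernoulli B -> is_bernoulli B' -> forall n : nat, B n = B' n.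
Proof.
intros (r & Hr & H) (r' & Hr' & H') n.
set (a := fun k => B k / INR (fact k)). set (a' := fun k => B' k / INR (fact k)).
assert (Hm : 0 < Rmin r r') by now apply Rmin_pos.
assert (Hl := Rmin_l r r'). assert (Hl' := Rmin_r r r').
set (m := Rmin r r') in *.
assert (HS : forall t, 0 < Rabs t < m -> is_pseries a t (t / (exp t - 1))).
{ intros t Ht. apply is_bernoulli_pseries, H. lra. }
assert (HS' : forall t, 0 < Rabs t < m -> is_pseries a' t (t / (exp t - 1))).
{ intros t Ht. apply is_bernoulli_pseries, H'. lra. }
assert (Hh : 0 < Rabs (m / 2) < m) by (rewrite Rabs_pos_eq; lra).
assert (Ca : Rbar_lt 0 (CV_radius a)).
{ apply (pseries_CV_radius_pos a (m / 2) _ ltac:(lra) (HS _ Hh)). }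
assert (Ca' : Rbar_lt 0 (CV_radius a')).
{ apply (pseries_CV_radius_pos a' (m / 2) _ ltac:(lra) (HS' _ Hh)). }
assert (E : forall t, 0 < Rabs t < m -> PSeries a t = PSeries a' t).
{ intros t Ht. rewrite (is_pseries_unique _ _ _ (HS t Ht)).
  symmetry. apply is_pseries_unique, HS', Ht. }
assert (L : forall b, Rbar_lt 0 (CV_radius b) -> is_lim (PSeries b) 0 (b 0%nat)).
{ intros b Hb. rewrite <- PSeries_0.
  apply is_lim_continuity, PSeries_continuity. now rewrite Rabs_R0. }
assert (E0 : a 0%nat = a' 0%nat).
{ assert (L1 := is_lim_unique _ _ _ (L a Ca)).
  assert (L2 : is_lim (PSeries a) 0 (a' 0%nat)).
  { apply (is_lim_ext_loc (PSeries a')); [|exact (L a' Ca')].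
    exists (mkposreal m Hm). intros t Ht Hne. symmetry. apply E.
    split; [now apply Rabs_pos_lt|].
    change (Rabs (t - 0) < m) in Ht. now rewrite Rminus_0_r in Ht. }
  rewrite (is_lim_unique _ _ _ L2) in L1. now inversion L1. }
assert (En : a n = a' n).
{ apply PSeries_ext_recip; [exact Ca|exact Ca'|].
  exists (mkposreal m Hm). intros t Ht.
  change (Rabs (t - 0) < m) in Ht. rewrite Rminus_0_r in Ht.
  destruct (Req_dec t 0) as [->|Hne].
  - now rewrite !PSeries_0.
  - apply E. split; [now apply Rabs_pos_lt|exact Ht]. }
unfold a, a' in En. apply Rmult_eq_reg_r with (/ INR (fact n)); [exact En|].
apply Rinv_neq_0_compat, INR_fact_neq_0.
Qed.

(* Main.v *)
Require Import Defs.
From Stdlib Require Import Reals Arith Lra Lia.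
From Coquelicot Require Import Coquelicot.
Open Scope R_scope.

(** Evaluating the cosine series of [cosh (t (1/2 - x))] at [x = 0], by means of
    the Dirichlet kernel, gives the partial fraction expansion
    [t / (exp t - 1) = 1 - t / 2 + sum_(k >= 1) 2 t^2 / (t^2 + (2 pi k)^2)].
    Expanding each term as a geometric series in [t^2] turns the right-hand side
    into a power series, and uniqueness of its coefficients yields Euler's formula
    [|B_(2n)| = 2 (2n)! zeta (2n) / (2 pi)^(2n)].  Both identities are
    rearrangements of it, as [r_n^(4n)] is [2^(2n-1) |B_(2n)|]. *)

(** * Oscillatory integrals *)

Lemma sum_Sn_R (a : nat -> R) (n : nat) : sum_n a (S n) = sum_n a n + a (S n).
Proof. exact (sum_Sn a n). Qed.

(** Integration by parts moves the oscillation onto a factor [cos (w * x) / w]. The boundary terms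
    and the integral of [h'] against this factor are all of order [1 / w], with constants
    independent of [w]. *)
Lemma riemann_lebesgue_C1 (h h' : R -> R) (a b : R) :
  a <= b ->
  (forall x, a <= x <= b -> is_derive h x (h' x)) ->
  (forall x, a <= x <= b -> continuous h' x) ->
  exists K, forall w, 0 < w -> Rabs (RInt (fun x => h x * sin (w * x)) a b) <= K / w.
Proof.
intros Hab Hd Hc.
assert (Hch : forall x, a <= x <= b -> continuous h x).
{ intros x Hx. apply (ex_derive_continuous h). exists (h' x). now apply Hd. }
destruct (continuity_ab_maj (fun x => Rabs (h' x)) a b Hab) as (xM & HM & _).
{ intros c Hx. apply continuity_pt_filterlim.
  apply (continuous_comp h' Rabs); [now apply Hc|apply continuous_Rabs]. }
set (M := Rabs (h' xM)) in *.
exists (Rabs (h a) + Rabs (h b) + (b - a) * M). intros w Hw.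
set (g := fun x => h' x * (cos (w * x) / w)).
assert (Hcg : forall x, a <= x <= b -> continuous g x).
{ intros x Hx. unfold g. apply (continuous_mult h'); [now apply Hc|].
  apply (ex_derive_continuous (fun y => cos (w * y) / w)). auto_derive. exact I. }
assert (Hcs : forall x, a <= x <= b -> continuous (fun x => h x * sin (w * x)) x).
{ intros x Hx. apply (continuous_mult h); [now apply Hch|].
  apply (ex_derive_continuous (fun y => sin (w * y))). auto_derive. exact I. }
assert (Eg : ex_RInt g a b).
{ apply (ex_RInt_continuous (V := R_CompleteNormedModule)).
  rewrite Rmin_left, Rmax_right by lra. exact Hcg. }
assert (Es : ex_RInt (fun x => h x * sin (w * x)) a b).
{ apply (ex_RInt_continuous (V := R_CompleteNormedModule)).
  rewrite Rmin_left, Rmax_right by lra. exact Hcs. }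
(* The derivative of [G] is [h x * sin (w * x) - g x], so the wanted integral is [G b - G a] plus
   the integral of [g]. *)
set (G := fun x => - h x * (cos (w * x) / w)).
assert (HG : is_RInt (fun x => minus (h x * sin (w * x)) (g x)) a b (G b - G a)).
{ apply (is_RInt_derive (V := R_CompleteNormedModule) G);
    rewrite Rmin_left, Rmax_right by lra; intros x Hx.
  - unfold G, g. assert (D := Hd x Hx).
    auto_derive; [now exists (h' x)|].
    replace (Derive (fun x => h x) x) with (h' x)
      by (symmetry; apply is_derive_unique, D).
    unfold minus, plus, opp; simpl. field. lra.
  - apply (continuous_minus (V := R_NormedModule) (fun x => h x * sin (w * x)) g); [now apply Hcs|now apply Hcg]. }
apply (is_RInt_unique (V := R_CompleteNormedModule)) in HG.
rewrite (RInt_minus (V := R_CompleteNormedModule)) in HG by assumption.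
unfold minus, plus, opp in HG; simpl in HG.
assert (Bc : forall x y, Rabs (x * (cos y / w)) <= Rabs x / w).
{ intros x y. unfold Rdiv. rewrite !Rabs_mult, (Rabs_pos_eq (/ w))
    by (apply Rlt_le, Rinv_0_lt_compat; lra).
  assert (C := COS_bound y). assert (Hi := Rinv_0_lt_compat _ Hw).
  assert (C' : Rabs (cos y) <= 1) by (apply Rabs_le; lra).
  apply Rmult_le_compat_l; [apply Rabs_pos|]. nra. }
assert (Bg : Rabs (RInt g a b) <= (b - a) * (M / w)).
{ apply abs_RInt_le_const; [exact Hab|exact Eg|]. intros x Hx.
  eapply Rle_trans; [apply Bc|]. apply Rmult_le_compat_r.
  - apply Rlt_le, Rinv_0_lt_compat; lra.
  - now apply HM. }
replace (RInt (fun x => h x * sin (w * x)) a b) with (G b - G a + RInt g a b) by lra.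
assert (B1 := Bc (- h b) (w * b)). assert (B2 := Bc (- h a) (w * a)).
rewrite Rabs_Ropp in B1, B2.
eapply Rle_trans; [apply Rabs_triang|].
assert (B3 := Rabs_triang (G b) (- G a)). rewrite Rabs_Ropp in B3. unfold G in *.
replace ((Rabs (h a) + Rabs (h b) + (b - a) * M) / w)
  with (Rabs (h a) / w + Rabs (h b) / w + (b - a) * (M / w)) by (field; lra).
unfold Rminus in *. lra.
Qed.

(** * Dirichlet kernel and convergence of cosine series at 0 *)

(** The kernel has [N + 1] cosine terms, because [sum_n] ranges over [0..N]. *)
Definition dirichlet (N : nat) (x : R) : R :=
  1 + 2 * sum_n (fun k => cos (2 * PI * INR (S k) * x)) N.

(** The sum telescopes, since [2 sin (pi x) cos (2 pi m x)] is
    [sin ((2m+1) pi x) - sin ((2m-1) pi x)]. The last index is [m = N + 1], whence [2 N + 3]. *)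
Lemma dirichlet_sin (N : nat) (x : R) :
  sin (PI * x) * dirichlet N x = sin ((2 * INR N + 3) * PI * x).
Proof.
unfold dirichlet. induction N as [|N IH].
- rewrite sum_O. simpl INR.
  replace ((2 * 0 + 3) * PI * x) with (2 * (PI * x) + PI * x) by ring.
  replace (2 * PI * 1 * x) with (2 * (PI * x)) by ring.
  rewrite sin_plus, cos_2a_sin, sin_2a.
  assert (H : cos (PI * x) * cos (PI * x) = 1 - sin (PI * x) * sin (PI * x)) by apply cos2.
  rewrite (Rmult_assoc (2 * sin _)), H. ring.
- rewrite sum_Sn_R, (Rmult_plus_distr_l 2), <- Rplus_assoc, Rmult_plus_distr_l.
  rewrite IH, !S_INR.
  replace ((2 * (INR N + 1) + 3) * PI * x)
    with (2 * PI * (INR N + 1 + 1) * x + PI * x) by ring.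
  replace ((2 * INR N + 3) * PI * x)
    with (2 * PI * (INR N + 1 + 1) * x - PI * x) by ring.
  rewrite sin_plus, sin_minus. ring.
Qed.

(** As [pi > 3], the interval [[0, 1]] lies below [pi / 3], where the cosine is at least [1 / 2];
    the mean value theorem integrates this bound. *)
Lemma sin_ge_half (y : R) : 0 <= y <= 1 -> y / 2 <= sin y.
Proof.
intros Hy.
destruct (MVT_gen (fun y => sin y - y / 2) 0 y (fun y => cos y - 1 / 2)) as (c & Hc & E).
- intros x _. auto_derive; [exact I|]. lra.
- intros x _. apply continuity_pt_filterlim.
  apply (ex_derive_continuous (fun y => sin y - y / 2)). auto_derive. exact I.
- rewrite Rmin_left, Rmax_right in Hc by lra. rewrite sin_0 in E.
  assert (H3 := PI2_3_2).
  assert (HP := PI_4).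
  assert (C : cos (PI / 3) <= cos c) by (apply cos_decr_1; lra).
  rewrite cos_PI3 in C. nra.
Qed.


Lemma continuous_dirichlet (N : nat) (x : R) : continuous (dirichlet N) x.
Proof.
unfold dirichlet. apply (ex_derive_continuous (V := R_NormedModule)).
apply (ex_derive_plus (V := R_NormedModule) (fun _ => 1)); [apply ex_derive_const|].
apply (ex_derive_scal (fun x => sum_n (fun k => cos (2 * PI * INR (S k) * x)) N) 2).
apply (ex_derive_sum_n (fun k x => cos (2 * PI * INR (S k) * x))).
intros k _. auto_derive. exact I.
Qed.

Lemma is_RInt_dirichlet (f : R -> R) (a b I0 : R) (I : nat -> R) (N : nat) :
  is_RInt f a b I0 ->
  (forall k, is_RInt (fun x => f x * cos (2 * PI * INR (S k) * x)) a b (I k)) ->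
  is_RInt (fun x => f x * dirichlet N x) a b (I0 + 2 * sum_n I N).
Proof.
intros H0 HI.
apply is_RInt_ext with (fun x => plus (f x)
  (scal 2 (f x * sum_n (fun k => cos (2 * PI * INR (S k) * x)) N))).
{ intros x _. unfold dirichlet, plus, scal; simpl; unfold mult; simpl.
  generalize (sum_n (fun k => cos (2 * PI * INR (S k) * x)) N). intros s. simpl. ring. }
apply (is_RInt_plus (V := R_NormedModule)); [exact H0|].
apply (is_RInt_scal (V := R_NormedModule)).
induction N as [|N IH].
- rewrite sum_O. eapply is_RInt_ext; [|apply (HI 0%nat)].
  intros x _. now rewrite sum_O.
- rewrite sum_Sn. eapply is_RInt_ext; [|exact (is_RInt_plus _ _ _ _ _ _ IH (HI (S N)))].
  intros x _. rewrite sum_Sn_R. symmetry. apply Rmult_plus_distr_l.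
Qed.

(** Each cosine integrates to a multiple of [sin (pi m) = 0], so only the constant term of the
    kernel contributes. *)
Lemma is_RInt_dirichlet_1 (N : nat) : is_RInt (dirichlet N) 0 (1 / 2) (1 / 2).
Proof.
assert (H : is_RInt (fun x => 1 * dirichlet N x) 0 (1 / 2)
              (1 / 2 + 2 * sum_n (fun _ => 0) N)).
{ apply (is_RInt_dirichlet (fun _ => 1)).
  - assert (C := is_RInt_const (V := R_NormedModule) 0 (1 / 2) 1).
    unfold scal in C; simpl in C; unfold mult in C; simpl in C.
    replace (1 / 2) with ((1 / 2 - 0) * 1) at 2 by lra. exact C.
  - intros k. set (m := INR (S k)).
    assert (Hm : 0 < m) by (apply lt_0_INR; lia).
    assert (HP := PI_RGT_0).
    set (G := fun x => sin (2 * PI * m * x) / (2 * PI * m)).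
    replace 0 with (minus (G (1 / 2)) (G 0)) at 2.
    + apply (is_RInt_derive (V := R_CompleteNormedModule) G); intros x _.
      * unfold G. auto_derive; [exact I|]. field. lra.
      * apply (ex_derive_continuous (fun x => 1 * cos (2 * PI * m * x))).
        auto_derive. exact I.
    + unfold G, minus, plus, opp; simpl.
      rewrite Rmult_0_r, sin_0.
      rewrite (sin_eq_0_1 (2 * PI * m * (1 / 2))); [field; lra|].
      exists (Z.of_nat (S k)). rewrite <- INR_IZR_INZ. fold m. field. }
rewrite sum_n_const in H. replace (1 / 2 + 2 * (INR (S N) * 0)) with (1 / 2) in H by ring.
eapply is_RInt_ext; [|exact H]. intros x _. apply Rmult_1_l.
Qed.

(** The kernel has mass [1 / 2] on [[0, 1/2]], which accounts for [f 0 / 2]. What remains is to show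
    that [F = f - f 0], which vanishes at 0, contributes nothing in the limit. *)
Lemma dirichlet_convergence (f f' : R -> R) :
  (forall x, is_derive f x (f' x)) -> (forall x, continuous f' x) ->
  is_lim_seq (fun N => RInt (fun x => f x * dirichlet N x) 0 (1 / 2)) (f 0 / 2).
Proof.
intros Hd Hc.
assert (Hcf : forall x, continuous f x).
{ intros x. apply (ex_derive_continuous f). now exists (f' x). }
set (F := fun x => f x - f 0).
assert (HF : forall x, continuous F x).
{ intros x. apply (continuous_minus (V := R_NormedModule) f (fun _ => f 0)).
  - apply Hcf.
  - apply continuous_const. }
assert (HFD : forall N a b, ex_RInt (fun x => F x * dirichlet N x) a b).
{ intros N a b. apply (ex_RInt_continuous (V := R_CompleteNormedModule)).
  intros x _. apply (continuous_mult F); [apply HF|apply continuous_dirichlet]. }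
apply is_lim_seq_ext with (fun N => RInt (fun x => F x * dirichlet N x) 0 (1 / 2) + f 0 / 2).
{ intros N. symmetry. apply is_RInt_unique.
  assert (H := is_RInt_plus _ _ _ _ _ _ (RInt_correct _ _ _ (HFD N 0 (1 / 2)))
    (is_RInt_scal _ _ _ (f 0) _ (is_RInt_dirichlet_1 N))).
  replace (f 0 / 2) with (scal (f 0) (1 / 2))
    by (unfold scal; simpl; unfold mult; simpl; field).
  eapply is_RInt_ext; [|exact H]. intros x _.
  unfold F, plus, scal; simpl; unfold mult; simpl. ring. }
replace (Finite (f 0 / 2)) with (Rbar_plus 0 (f 0 / 2)) by (simpl; f_equal; ring).
apply is_lim_seq_plus'; [|apply is_lim_seq_const].
(* By the mean value theorem, the maximum of [|f'|] on [[0, 1/2]] serves as [K]. *)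
assert (HK : exists K, 0 <= K /\ forall x, 0 <= x <= 1 / 2 -> Rabs (F x) <= K * x).
{ destruct (continuity_ab_maj (fun x => Rabs (f' x)) 0 (1 / 2)) as (xM & HM & _); [lra| |].
  { intros c _. apply continuity_pt_filterlim.
    apply (continuous_comp f' Rabs); [apply Hc|apply continuous_Rabs]. }
  exists (Rabs (f' xM)). split; [apply Rabs_pos|]. intros x Hx.
  destruct (MVT_gen f 0 x f') as (c & Hcx & E).
  - intros; apply Hd.
  - intros y _. apply continuity_pt_filterlim, Hcf.
  - rewrite Rmin_left, Rmax_right in Hcx by lra.
    unfold F. rewrite E, Rminus_0_r, Rabs_mult, (Rabs_pos_eq x) by lra.
    apply Rmult_le_compat_r; [lra|]. apply HM. lra. }
destruct HK as (K & HK0 & HK).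
assert (HPI := PI_RGT_0). assert (HPI3 := PI2_3_2). assert (HPI4 := PI_4).
(* Near 0 the kernel is at most [1 / x], which the bound [|F x| <= K x]
   compensates; away from 0 the Riemann-Lebesgue lemma applies to [F / sin]. *)
apply is_lim_seq_spec. intros eps. assert (He := cond_pos eps).
assert (Hq : 0 < eps / (2 * (K + 1))) by (apply Rdiv_lt_0_compat; lra).
(* The bound [1 / 4] ensures [PI * x <= 1] on [[0, d]], as [sin_ge_half] requires; the other bound
   makes the part near 0 smaller than [eps / 2]. The [K + 1] avoids division by zero when
   [K = 0]. *)
set (d := Rmin (1 / 4) (eps / (2 * (K + 1)))).
assert (Hd0 : 0 < d) by (apply Rmin_pos; lra).
assert (Hd1 : d <= 1 / 4) by apply Rmin_l.
assert (HdK : d * K < eps / 2).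
{ apply Rlt_le_trans with (d * (K + 1)); [nra|].
  apply Rle_trans with (eps / (2 * (K + 1)) * (K + 1)).
  - apply Rmult_le_compat_r; [lra|apply Rmin_r].
  - right. field. lra. }
assert (Hsin : forall x, 0 < x <= 1 / 2 -> 0 < sin (PI * x)).
{ intros x Hx. apply sin_gt_0; nra. }
destruct (riemann_lebesgue_C1 (fun x => F x / sin (PI * x))
  (fun x => f' x / sin (PI * x) - F x * (PI * cos (PI * x)) / (sin (PI * x)) ^ 2)
  d (1 / 2)) as (L & HL).
{ lra. }
{ intros x Hx. assert (Hs := Hsin x ltac:(lra)). unfold F.
  auto_derive.
  - split; [exists (f' x); apply Hd|]. split; [lra|exact I].
  - replace (Derive (fun x => f x) x) with (f' x)
      by (symmetry; apply is_derive_unique, Hd).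
    field. lra. }
{ intros x Hx. assert (Hs := Hsin x ltac:(lra)).
  apply (continuous_minus (V := R_NormedModule)
    (fun x => f' x / sin (PI * x))
    (fun x => F x * (PI * cos (PI * x)) / (sin (PI * x)) ^ 2)).
  - apply (continuous_mult f' (fun x => / sin (PI * x))); [apply Hc|].
    apply (ex_derive_continuous (fun x => / sin (PI * x))). auto_derive. lra.
  - apply continuous_ext with (fun x => F x * (PI * cos (PI * x) / (sin (PI * x)) ^ 2)).
    { intros y. symmetry. apply Rmult_assoc. }
    apply (continuous_mult F); [apply HF|].
    apply (ex_derive_continuous (fun x => PI * cos (PI * x) / (sin (PI * x)) ^ 2)).
    auto_derive. nra. }
(* The frequency [w = (2 N + 3) PI] exceeds [N + 1], so this choice of [N0] gives [L / w < eps / 2]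
   for the part away from 0. *)
destruct (INR_unbounded (2 * L / eps)) as (N0 & HN0).
exists N0. intros N HN. rewrite Rminus_0_r.
rewrite <- (RInt_Chasles (V := R_CompleteNormedModule) _ 0 d (1 / 2)) by apply HFD.
assert (B1 : Rabs (RInt (fun x => F x * dirichlet N x) 0 d) <= (d - 0) * K).
{ apply abs_RInt_le_const; [lra|apply HFD|]. intros x Hx.
  destruct (Req_dec x 0) as [->|Hx0].
  - unfold F. rewrite Rminus_diag, Rmult_0_l, Rabs_R0. exact HK0.
  - assert (Hs : x <= sin (PI * x)).
    { assert (HS := sin_ge_half (PI * x)). nra. }
    assert (Hk := HK x ltac:(lra)).
    assert (D := dirichlet_sin N x).
    assert (Hb : Rabs (sin (PI * x) * dirichlet N x) <= 1).
    { rewrite D. apply Rabs_le. assert (H := SIN_bound ((2 * INR N + 3) * PI * x)). lra. }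
    rewrite Rabs_mult, (Rabs_pos_eq (sin _)) in Hb by lra.
    rewrite Rabs_mult.
    assert (Hp := Rabs_pos (dirichlet N x)).
    apply Rle_trans with (K * x * Rabs (dirichlet N x)).
    { now apply Rmult_le_compat_r. }
    assert (x * Rabs (dirichlet N x) <= 1) by nra. nra. }
set (w := (2 * INR N + 3) * PI).
assert (HNp := pos_INR N).
assert (Hw : INR N + 1 < w) by (unfold w; nra).
assert (B2 : Rabs (RInt (fun x => F x * dirichlet N x) d (1 / 2)) <= L / w).
{ rewrite (RInt_ext (V := R_CompleteNormedModule) _ (fun x => F x / sin (PI * x) * sin (w * x))).
  - apply HL. lra.
  - intros x. rewrite Rmin_left, Rmax_right by lra. intros Hx.
    assert (Hs := Hsin x ltac:(lra)).
    unfold w. rewrite <- dirichlet_sin. simpl. field. lra. }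
assert (B3 : L / w < eps / 2).
{ apply le_INR in HN.
  apply Rmult_lt_reg_r with (2 * w / eps); [apply Rdiv_lt_0_compat; lra|].
  replace (L / w * (2 * w / eps)) with (2 * L / eps) by (field; lra).
  replace (eps / 2 * (2 * w / eps)) with w by (field; lra). lra. }
unfold plus; simpl plus.
eapply Rle_lt_trans; [apply Rabs_triang|]. lra.
Qed.

(** * Partial fractions of [t / (exp t - 1)] *)

(** The value to reach is [(t / 2) coth (t / 2) - 1]. It arises from [f x = cosh (t (1/2 - x))],
    because [f 0 / s] is [coth (t / 2)] for [s = sinh (t / 2)]. *)
Lemma coth_partial_fractions (t : R) : t <> 0 ->
  is_series (fun k => 2 * t ^ 2 / (t ^ 2 + (2 * PI * INR (S k)) ^ 2))
    (t / (exp t - 1) + t / 2 - 1).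
Proof.
intros Ht. assert (HPI := PI_RGT_0).
assert (Hsq : 0 < t ^ 2) by (rewrite <- Rsqr_pow2; now apply Rsqr_pos_lt).
set (s := sinh (t / 2)).
assert (Hs : s <> 0).
{ unfold s. destruct (Rtotal_order t 0) as [H|[H|H]]; [|lra|].
  - apply Rlt_not_eq. rewrite <- sinh_0. apply sinh_lt. lra.
  - apply Rgt_not_eq. rewrite <- sinh_0. apply sinh_lt. lra. }
set (f := fun x => cosh (t * (1 / 2 - x))).
set (f' := fun x => - t * sinh (t * (1 / 2 - x))).
assert (Hd : forall x, is_derive f x (f' x)).
{ intros x. unfold f, f', Rminus. auto_derive; [exact I|]. ring. }
assert (Hcf : forall x, continuous f x).
{ intros x. apply (ex_derive_continuous f). now exists (f' x). }
assert (Hc : forall x, continuous f' x).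
{ intros x. apply (ex_derive_continuous (fun x => - t * sinh (t * (1 / 2 - x)))).
  auto_derive. exact I. }
assert (L := dirichlet_convergence f f' Hd Hc).
assert (E0 : is_RInt f 0 (1 / 2) (s / t)).
{ set (G := fun x => - sinh (t * (1 / 2 - x)) / t).
  replace (s / t) with (minus (G (1 / 2)) (G 0)).
  - apply (is_RInt_derive (V := R_CompleteNormedModule) G); intros x _; [|apply Hcf].
    unfold G, f, Rminus. auto_derive; [exact I|]. field. exact Ht.
  - unfold G, minus, plus, opp; simpl.
    replace (t * (1 / 2 - 1 / 2)) with 0 by field.
    replace (t * (1 / 2 - 0)) with (t / 2) by field.
    rewrite sinh_0. fold s. field. exact Ht. }
assert (Ek : forall k, is_RInt (fun x => f x * cos (2 * PI * INR (S k) * x)) 0 (1 / 2)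
  (t * s / (t ^ 2 + (2 * PI * INR (S k)) ^ 2))).
{ intros k. set (w := 2 * PI * INR (S k)).
  assert (Hw := pow2_ge_0 w).
  (* Since [f'' = t^2 f], differentiating the numerator leaves [(t^2 + w^2) f cos (w x)]. At [1 / 2]
     both [f'] and the sine vanish, so only [f' 0 = - t s] survives. *)
  set (G := fun x => (w * f x * sin (w * x) + f' x * cos (w * x)) / (t ^ 2 + w ^ 2)).
  replace (t * s / (t ^ 2 + w ^ 2)) with (minus (G (1 / 2)) (G 0)).
  - apply (is_RInt_derive (V := R_CompleteNormedModule) G); intros x _.
    + unfold G, f, f', Rminus. auto_derive; [exact I|]. field. lra.
    + apply (continuous_mult f); [apply Hcf|].
      apply (ex_derive_continuous (fun x => cos (w * x))). auto_derive. exact I.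
  - unfold G, f, f', minus, plus, opp; simpl plus; simpl opp; cbv beta.
    replace (t * (1 / 2 - 1 / 2)) with 0 by field.
    replace (t * (1 / 2 - 0)) with (t / 2) by field.
    rewrite sinh_0, !Rmult_0_r, sin_0, cos_0. fold s.
    rewrite (sin_eq_0_1 (w * (1 / 2))); [simpl; field; simpl in *; lra|].
    exists (Z.of_nat (S k)). rewrite <- INR_IZR_INZ. unfold w. field. }
assert (EN : forall N, RInt (fun x => f x * dirichlet N x) 0 (1 / 2)
  = s / t + 2 * sum_n (fun k => t * s / (t ^ 2 + (2 * PI * INR (S k)) ^ 2)) N).
{ intros N. apply is_RInt_unique. now apply is_RInt_dirichlet. }
apply (is_lim_seq_ext _ _ _ EN) in L.
(* Multiplying by [t / s] turns the constant term [s / t] into 1, which is then subtracted. *)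
assert (M : is_lim_seq (sum_n (fun k => 2 * t ^ 2 / (t ^ 2 + (2 * PI * INR (S k)) ^ 2)))
  (t / s * (f 0 / 2) - 1)).
{ apply is_lim_seq_ext with (fun N => t / s *
    (s / t + 2 * sum_n (fun k => t * s / (t ^ 2 + (2 * PI * INR (S k)) ^ 2)) N) - 1).
  - intros N. rewrite Rmult_plus_distr_l.
    replace (t / s * (s / t)) with 1 by (field; auto).
    unfold Rminus. rewrite Rplus_comm, <- Rplus_assoc, Rplus_opp_l, Rplus_0_l, <- Rmult_assoc.
    rewrite <- (sum_n_mult_l (K := R_Ring)). apply sum_n_ext. intros k.
    assert (E : forall w, t / s * 2 * (t * s / (t ^ 2 + w ^ 2)) = 2 * t ^ 2 / (t ^ 2 + w ^ 2)).
    { intros w. assert (Hw := pow2_ge_0 w). field. split; [lra|auto]. }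
    apply E.
  - apply is_lim_seq_minus'; [|apply is_lim_seq_const].
    apply (is_lim_seq_scal_l _ (t / s) (f 0 / 2) L). }
replace (t / (exp t - 1) + t / 2 - 1) with (t / s * (f 0 / 2) - 1); [exact M|].
unfold f. replace (t * (1 / 2 - 0)) with (t / 2) by field.
assert (Ee : exp t = exp (t / 2) * exp (t / 2)) by (rewrite <- exp_plus; f_equal; field).
unfold s, cosh, sinh. rewrite exp_Ropp, Ee.
assert (Hp := exp_pos (t / 2)).
assert (He : exp (t / 2) * exp (t / 2) - 1 <> 0).
{ rewrite <- Ee. now apply exp_sub_1_neq_0. }
field. repeat split; auto; lra.
Qed.

(** * Expansion of a sum of simple fractions into a power series *)

Lemma Rinv_pow_le (a : R) (n : nat) : 1 <= a -> 0 < / a ^ S n <= / a.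
Proof.
intros Ha. split; [apply Rinv_0_lt_compat, pow_lt; lra|].
apply Rinv_le_contravar; [lra|]. simpl. assert (H := pow_R1_Rle a n Ha). nra.
Qed.

Lemma ex_series_inv_pow (a : nat -> R) (n : nat) :
  (forall k, 1 <= a k) -> ex_series (fun k => / a k) ->
  ex_series (fun k => / a k ^ S n).
Proof.
intros Ha He. apply (ex_series_le (V := R_CompleteNormedModule) _ (fun k => / a k)); [|exact He].
intros k. assert (H := Rinv_pow_le (a k) n (Ha k)).
change (Rabs (/ a k ^ S n) <= / a k). rewrite Rabs_pos_eq; lra.
Qed.

(** The remainders [rem] of the geometric series in [- u / a k] make it possible
    to sum over [k] after each step, with no exchange of two infinite sums. *)
Lemma is_series_shifted_inv (a : nat -> R) (u : R) :
  (forall k, 1 <= a k) -> ex_series (fun k => / a k) -> 0 <= u < 1 ->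
  is_series (fun j => (-1) ^ j * Series (fun k => / a k ^ S j) * u ^ j)
    (Series (fun k => / (u + a k))).
Proof.
intros Ha He Hu.
set (rem := fun n k => / (a k ^ n * (u + a k))).
assert (Hrem : forall n k, 0 <= rem n k <= / a k).
{ intros n k. unfold rem. assert (Hk := Ha k). assert (Hp := pow_R1_Rle (a k) n Hk).
  split.
  - apply Rlt_le, Rinv_0_lt_compat. nra.
  - apply Rinv_le_contravar; nra. }
assert (Erem : forall n, ex_series (rem n)).
{ intros n. apply (ex_series_le (V := R_CompleteNormedModule) _ (fun k => / a k)); [|exact He].
  intros k. change (Rabs (rem n k) <= / a k). rewrite Rabs_pos_eq; apply Hrem. }
(* Termwise, [1 / (a^n (u + a)) = 1 / a^(n+1) - u / (a^(n+1) (u + a))]. *)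
assert (Step : forall n, Series (rem n) = Series (fun k => / a k ^ S n) - u * Series (rem (S n))).
{ intros n. rewrite <- Series_scal_l, <- Series_minus.
  - apply Series_ext. intros k. unfold rem. assert (Hk := Ha k).
    assert (Hp := pow_R1_Rle (a k) n Hk). simpl. field. lra.
  - now apply ex_series_inv_pow.
  - apply (ex_series_scal (V := R_NormedModule) u (rem (S n))), Erem. }
assert (Sum : forall N, Series (rem 0%nat) - (- u) ^ S N * Series (rem (S N))
  = sum_n (fun j => (-1) ^ j * Series (fun k => / a k ^ S j) * u ^ j) N).
{ intros N. induction N as [|N IH].
  - rewrite sum_O, (Step 0%nat). simpl. ring.
  - rewrite sum_Sn_R, <- IH, (Step (S N)).
    replace ((- u) ^ S (S N)) with (- u * (- u) ^ S N) by reflexivity.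
    replace ((- u) ^ S N) with ((-1) ^ S N * u ^ S N)
      by (rewrite <- Rpow_mult_distr; f_equal; ring).
    ring. }
change (is_lim_seq (sum_n (fun j => (-1) ^ j * Series (fun k => / a k ^ S j) * u ^ j))
  (Series (fun k => / (u + a k)))).
apply (is_lim_seq_ext _ _ _ Sum).
replace (Finite (Series (fun k => / (u + a k)))) with (Finite (Series (rem 0%nat) - 0)).
2:{ f_equal. rewrite Rminus_0_r. apply Series_ext. intros k. unfold rem. simpl.
  now rewrite Rmult_1_l. }
apply is_lim_seq_minus'; [apply is_lim_seq_const|].
apply is_lim_seq_abs_0.
apply is_lim_seq_le_le with (fun _ => 0) (fun N => u ^ S N * Series (fun k => / a k)).
- intros N. split; [apply Rabs_pos|].
  rewrite Rabs_mult, <- RPow_abs, Rabs_Ropp, (Rabs_pos_eq u) by lra.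
  apply Rmult_le_compat_l; [apply pow_le; lra|].
  assert (P : 0 <= Series (rem (S N))).
  (* Zero is written as a product so that [Series_scal_l] evaluates the zero series. *)
  { replace 0 with (Series (fun _ => 0 * 0)) by (rewrite Series_scal_l; ring).
    apply Series_le; [|apply Erem]. intros k. rewrite Rmult_0_l.
    split; [lra|apply Hrem]. }
  rewrite Rabs_pos_eq by exact P. apply Series_le; [apply Hrem|exact He].
- apply is_lim_seq_const.
- replace (Finite 0) with (Rbar_mult 0 (Series (fun k => / a k))) by (simpl; f_equal; ring).
  apply is_lim_seq_scal_r.
  apply (is_lim_seq_incr_1 (fun N => u ^ N)), is_lim_seq_geom. rewrite Rabs_pos_eq; lra.
Qed.

(** * Explicit Bernoulli numbers *)

(** The poles of [t / (exp t - 1)] are the points where [t^2 = - freq_sq k]. *)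
Definition freq_sq (k : nat) : R := (2 * PI * INR (S k)) ^ 2.

Lemma freq_sq_ge_1 (k : nat) : 1 <= freq_sq k.
Proof.
unfold freq_sq. assert (H := PI2_3_2). assert (H1 := le_INR 1 (S k) ltac:(lia)).
simpl (INR 1) in H1. apply pow_R1_Rle. nra.
Qed.

(** Convergence comes from the partial fraction series at [t = 1]: for [a >= 1],
    [1 / a <= 2 / (1 + a)]. *)
Lemma ex_series_inv_freq_sq : ex_series (fun k => / freq_sq k).
Proof.
apply (ex_series_le (V := R_CompleteNormedModule) _ (fun k => 2 * 1 ^ 2 / (1 ^ 2 + (2 * PI * INR (S k)) ^ 2))).
- intros k. change (Rabs (/ freq_sq k) <= 2 * 1 ^ 2 / (1 ^ 2 + freq_sq k)).
  assert (H := freq_sq_ge_1 k).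
  rewrite Rabs_pos_eq by (apply Rlt_le, Rinv_0_lt_compat; lra).
  apply Rmult_le_reg_r with (freq_sq k * (1 ^ 2 + freq_sq k)); [nra|].
  field_simplify; nra.
- eexists. apply coth_partial_fractions. lra.
Qed.

(** This is the coefficient of [t ^ (2 j + 2)], not [t ^ (2 j)]: the partial fractions carry a
    factor [t ^ 2]. *)
Definition even_bernoulli_coef (j : nat) : R :=
  2 * ((-1) ^ j * Series (fun k => / freq_sq k ^ S j)).

(** The numbers [B m / m!]. *)
Definition bernoulli_coef (m : nat) : R :=
  match m with
  | 0%nat => 1
  | 1%nat => - (1 / 2)
  | S (S i) => if Nat.even i then even_bernoulli_coef (Nat.div2 i) else 0
  end.

Lemma is_bernoulli_bernoulli_coef :
  is_bernoulli (fun m => bernoulli_coef m * INR (fact m)).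
Proof.
(* The radius 1 gives the condition [t ^ 2 < 1] of [is_series_shifted_inv]; any positive radius
   satisfies the definition. *)
exists 1. split; [lra|]. intros t [Ht0 Ht1].
assert (Hn : t <> 0) by (intros ->; rewrite Rabs_R0 in Ht0; lra).
assert (Hu : 0 <= t ^ 2 < 1).
{ rewrite <- (pow2_abs t). nra. }
(* With the terms [1] and [- t / 2] removed and [t ^ 2] factored out, the even-indexed coefficients
   form a power series in [t ^ 2] and the odd-indexed ones vanish. *)
set (c := fun i => bernoulli_coef (S (S i))).
assert (P1 : is_pseries (fun j => c (2 * j)%nat) (t ^ 2)
               (2 * Series (fun k => / (t ^ 2 + freq_sq k)))).
{ assert (H := is_series_scal 2 _ _ (is_series_shifted_inv _ _ freq_sq_ge_1
    ex_series_inv_freq_sq Hu)).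
  eapply is_series_ext; [|exact H]. intros j.
  change (pow_n (t ^ 2) j) with ((t ^ 2) ^ j).
  unfold c, bernoulli_coef. rewrite Nat.even_even, Nat.div2_double.
  unfold even_bernoulli_coef.
  generalize (Series (fun k => / freq_sq k ^ S j)). intros z.
  assert (E : 2 * ((-1) ^ j * z * (t ^ 2) ^ j) = (t ^ 2) ^ j * (2 * ((-1) ^ j * z))) by ring.
  exact E. }
assert (P2 : is_pseries (fun j => c (2 * j + 1)%nat) (t ^ 2) 0).
{ apply is_pseries_ext with (fun _ => 0).
  - intros j. unfold c, bernoulli_coef. now rewrite Nat.even_odd.
  - apply (is_lim_seq_ext (fun _ => 0) _ 0); [|apply is_lim_seq_const].
    intros N. transitivity (sum_n (fun _ => 0) N).
    { rewrite sum_n_const. symmetry. apply Rmult_0_r. }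
    apply sum_n_ext. intros k.
    symmetry. apply (scal_zero_r (V := R_NormedModule)). }
assert (P := is_pseries_odd_even c t _ _ P1 P2).
rewrite Rmult_0_r, Rplus_0_r in P.
assert (E : t / (exp t - 1) + t / 2 - 1 = t ^ 2 * (2 * Series (fun k => / (t ^ 2 + freq_sq k)))).
{ rewrite <- (is_series_unique _ _ (coth_partial_fractions t Hn)).
  rewrite <- !Series_scal_l. apply Series_ext. intros k. unfold freq_sq, Rdiv. ring. }
apply (is_series_scal (t ^ 2)) in P.
apply is_series_ext with (fun k => bernoulli_coef k * t ^ k).
{ intros k.
  assert (F : bernoulli_coef k * t ^ k = bernoulli_coef k * INR (fact k) * t ^ k / INR (fact k)).
  { field. apply INR_fact_neq_0. }
  exact F. }
(* The two removed terms are split off, leaving the series [P], already multiplied by [t ^ 2]. *)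
apply is_series_decr_1, is_series_decr_1.
match goal with |- is_series _ ?l => replace l with
  (t ^ 2 * (2 * Series (fun k => / (t ^ 2 + freq_sq k)))) end.
- eapply is_series_ext; [|exact P]. intros k.
  assert (F : t ^ 2 * (t ^ k * c k) = c k * t ^ S (S k)) by (simpl; ring). exact F.
- rewrite <- E. unfold plus, opp; simpl. field. now apply exp_sub_1_neq_0.
Qed.

(** * Euler's formula and the two identities *)

Lemma zeta_even (n : nat) :
  zeta (INR (2 * n)) = (2 * PI) ^ (2 * n) * Series (fun k => / freq_sq k ^ n).
Proof.
unfold zeta. rewrite <- Series_scal_l. apply Series_ext. intros k.
assert (Hk : 0 < INR (S k)) by (apply lt_0_INR; lia).
unfold freq_sq. rewrite <- pow_mult, Rpower_pow, (Rpow_mult_distr (2 * PI)) by exact Hk.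
assert (HP := PI_RGT_0). field. split; apply pow_nonzero; lra.
Qed.

Lemma Series_pos (a : nat -> R) : (forall k, 0 < a k) -> ex_series a -> 0 < Series a.
Proof.
intros Ha He. rewrite Series_incr_1 by exact He.
assert (H : Series (fun k => 0 * a (S k)) <= Series (fun k => a (S k))).
{ apply Series_le; [|now apply ex_series_incr_1 in He].
  intros k. assert (H := Ha (S k)). lra. }
rewrite Series_scal_l in H. assert (H0 := Ha 0%nat). lra.
Qed.

Lemma Series_inv_freq_sq_pow_pos (n : nat) : (1 <= n)%nat ->
  0 < Series (fun k => / freq_sq k ^ n).
Proof.
intros Hn. apply Series_pos.
- intros k. assert (H := freq_sq_ge_1 k). apply Rinv_0_lt_compat, pow_lt. lra.
- replace n with (S (n - 1)) by lia.
  apply ex_series_inv_pow; [exact freq_sq_ge_1|exact ex_series_inv_freq_sq].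
Qed.

(** Uniqueness replaces [B] by the explicit sequence. Its entry at [2 n] uses
    [even_bernoulli_coef (n - 1)], whose sign the absolute value removes. *)
Lemma abs_bernoulli_even (B : nat -> R) (n : nat) : is_bernoulli B -> (1 <= n)%nat ->
  Rabs (B (2 * n)%nat) = 2 * Series (fun k => / freq_sq k ^ n) * INR (fact (2 * n)).
Proof.
intros HB Hn. rewrite (bernoulli_unique _ _ HB is_bernoulli_bernoulli_coef).
assert (HS := Series_inv_freq_sq_pow_pos n Hn).
assert (Hf := INR_fact_lt_0 (2 * n)).
rewrite Rabs_mult, (Rabs_pos_eq (INR _)) by lra. f_equal.
replace (2 * n)%nat with (S (S (2 * (n - 1)))) by lia. unfold bernoulli_coef.
rewrite Nat.even_even, Nat.div2_double. unfold even_bernoulli_coef.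
replace (S (n - 1)) with n by lia.
rewrite !Rabs_mult, pow_1_abs, (Rabs_pos_eq 2), (Rabs_pos_eq (Series _)) by lra. ring.
Qed.

Theorem mainTheorem4 (B : nat -> R) (HB : is_bernoulli B) (n : nat) (hn : (1 <= n)%nat) :
  Binomial.C (2 * n) n =
    PI ^ (2 * n) * bernoulli_root B n ^ (4 * n)
      / (INR (fact n) ^ 2 * zeta (INR (2 * n))) /\
  zeta (INR (2 * n)) =
    PI ^ (2 * n) * bernoulli_root B n ^ (4 * n)
      / (INR (fact n) ^ 2 * Binomial.C (2 * n) n).
Proof.
unfold bernoulli_root.
assert (H2 : 0 < 2 ^ (2 * n - 1)) by (apply pow_lt; lra).
destruct (nth_root_pow (4 * n) (2 ^ (2 * n - 1) * Rabs (B (2 * n)%nat))) as [_ ->].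
{ lia. }
{ apply Rmult_le_pos; [lra|apply Rabs_pos]. }
rewrite abs_bernoulli_even, zeta_even by assumption.
assert (HS := Series_inv_freq_sq_pow_pos n hn).
assert (HP : 0 < PI ^ (2 * n)) by apply pow_lt, PI_RGT_0.
rewrite Rpow_mult_distr.
(* Since [n >= 1], the subtraction in [2 * n - 1] is not truncated. The extra factor 2 cancels the
   one in [abs_bernoulli_even], and the rest is [C(2n, n) = (2n)! / (n!)^2]. *)
replace (2 ^ (2 * n)) with (2 * 2 ^ (2 * n - 1))
  by (rewrite tech_pow_Rmult; f_equal; lia).
unfold Binomial.C. replace (2 * n - n)%nat with n by lia.
assert (H2n := INR_fact_lt_0 (2 * n)). assert (Hfn := INR_fact_lt_0 n).
split; field; lra.
Qed.
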